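(* Let $P$ be a unification problem without repeated list variables. Then there is no infinite sequence $P \Rightarrow P_1 \Rightarrow P_2 \Rightarrow \cdots$ of transformation steps.
   Context: Expressions: built from integer constants, string constants, the constant $\mathtt{empty}$, variables of the disjoint types $\mathtt{int},\mathtt{string},\mathtt{atom},\mathtt{list}$, and list concatenation $\mathtt{:}$. Types: $\mathtt{int},\mathtt{string} < \mathtt{atom} < \mathtt{list}$, with $\mathtt{int}$ and $\mathtt{string}$ incomparable (written $\|$). After normalisation, each expression has a smallest type: integer constants/variables have type $\mathtt{int}$, string constants/variables type $\mathtt{string}$, atom variables type $\mathtt{atom}$, and $\mathtt{empty}$, list variables and concatenations of at least two items type $\mathtt{list}$. A simple expression uses no operator other than $\mathtt{:}$ and contains at most one occurrence of a list variable. Normalisation: apply $L\mathtt{:}\mathtt{empty} \to L$, $\mathtt{empty}\mathtt{:}L \to L$ exhaustively. A substitution maps variables to expressions of their type; $\sigma\circ\theta$ is defined by $x(\sigma\circ\theta) = (x\sigma)\theta$ if $x \in \mathrm{Dom}(\sigma)$ and $x\theta$ otherwise. A unification problem is either $\langle s = t, \sigma\rangle$ with $s,t$ simple list expressions without common variables and $\sigma$ a substitution, or a solved problem $\langle \varnothing, \sigma\rangle$, or $\mathtt{fail}$. Transformation relation $\Rightarrow$: in the rules below, $L,M$ range over simple expressions (possibly $\mathtt{empty}$), $\mathtt{x},\mathtt{y}$ over variables of any type, $\mathtt{a},\mathtt{b}$ over integer/string constants or variables of type $\mathtt{int},\mathtt{string},\mathtt{atom}$, and $\mathtt{s}$ over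 integer/string constants or variables of any type. A rule applies to $P$ if its premise, after instantiation and normalisation, is identical to $P$ and its side conditions hold; the result is the normalised conclusion. Fresh variables are new list variables. Remove: $\langle L=L,\sigma\rangle \Rightarrow \langle\varnothing,\sigma\rangle$. Decomp1: $\langle \mathtt{x}\mathtt{:}L = \mathtt{s}\mathtt{:}M,\sigma\rangle \Rightarrow \langle L=M, \sigma\circ\{\mathtt{x}\mapsto\mathtt{s}\}\rangle$ if $L\neq\mathtt{empty}$, $\mathrm{type}(\mathtt{x})=\mathtt{list}$. Decomp1': $\langle \mathtt{x}\mathtt{:}L = \mathtt{a}\mathtt{:}M,\sigma\rangle \Rightarrow \langle (L=M)\{\mathtt{x}\mapsto\mathtt{a}\}, \sigma\circ\{\mathtt{x}\mapsto\mathtt{a}\}\rangle$ if $L\neq\mathtt{empty}$, $\mathrm{type}(\mathtt{a})\le\mathrm{type}(\mathtt{x})\le\mathtt{atom}$. Decomp2: $\langle \mathtt{x}\mathtt{:}L = \mathtt{y}\mathtt{:}M,\sigma\rangle \Rightarrow \langle \mathtt{x'}\mathtt{:}L = M, \sigma\circ\{\mathtt{x}\mapsto\mathtt{y}\mathtt{:}\mathtt{x'}\}\rangle$ if $L\neq\mathtt{empty}$, $\mathtt{x},\mathtt{y}$ of type $\mathtt{list}$, $\mathtt{x'}$ fresh. Decomp2': $\langle \mathtt{x}\mathtt{:}L = \mathtt{y}\mathtt{:}M,\sigma\rangle \Rightarrow \langle L = \mathtt{y'}\mathtt{:}M, \sigma\circ\{\mathtt{y}\mapsto\mathtt{x}\mathtt{:}\mathtt{y'}\}\rangle$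 if $L\neq\mathtt{empty}$, $\mathtt{x},\mathtt{y}$ of type $\mathtt{list}$, $\mathtt{y'}$ fresh. Decomp3: $\langle \mathtt{s}\mathtt{:}L = \mathtt{s}\mathtt{:}M,\sigma\rangle \Rightarrow \langle L=M,\sigma\rangle$. Decomp4: $\langle \mathtt{x} = \mathtt{a}\mathtt{:}\mathtt{y},\sigma\rangle \Rightarrow \langle \mathtt{empty}=\mathtt{y}, \sigma\circ\{\mathtt{x}\mapsto\mathtt{a}\}\rangle$ if $\mathrm{type}(\mathtt{x})=\mathtt{atom}$, $\mathrm{type}(\mathtt{y})=\mathtt{list}$. Subst1: $\langle \mathtt{x} = L,\sigma\rangle \Rightarrow \langle\varnothing, \sigma\circ\{\mathtt{x}\mapsto L\}\rangle$ if $\mathtt{x}\notin\mathrm{Var}(L)$, $\mathrm{type}(\mathtt{x})\ge\mathrm{type}(L)$. Subst2: $\langle \mathtt{x}\mathtt{:}L = M,\sigma\rangle \Rightarrow \langle L=M, \sigma\circ\{\mathtt{x}\mapsto\mathtt{empty}\}\rangle$ if $L\neq\mathtt{empty}$, $\mathrm{type}(\mathtt{x})=\mathtt{list}$. Subst3: $\langle \mathtt{x}\mathtt{:}L = \mathtt{a}\mathtt{:}M,\sigma\rangle \Rightarrow \langle \mathtt{x'}\mathtt{:}L=M, \sigma\circ\{\mathtt{x}\mapsto\mathtt{a}\mathtt{:}\mathtt{x'}\}\rangle$ if $L\neq\mathtt{empty}$, $\mathtt{x'}$ fresh, $\mathrm{type}(\mathtt{x})=\mathtt{list}$. Orient1: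 $\langle \mathtt{a}\mathtt{:}M = \mathtt{x}\mathtt{:}L,\sigma\rangle \Rightarrow \langle \mathtt{x}\mathtt{:}L = \mathtt{a}\mathtt{:}M,\sigma\rangle$ if $\mathtt{a}$ is not a variable. Orient2: $\langle \mathtt{x}\mathtt{:}L = \mathtt{y},\sigma\rangle \Rightarrow \langle \mathtt{y} = \mathtt{x}\mathtt{:}L,\sigma\rangle$ if $L\neq\mathtt{empty}$, $\mathrm{type}(\mathtt{x})=\mathrm{type}(\mathtt{y})$. Orient3: $\langle \mathtt{y}\mathtt{:}M = \mathtt{x}\mathtt{:}L,\sigma\rangle \Rightarrow \langle \mathtt{x}\mathtt{:}L = \mathtt{y}\mathtt{:}M,\sigma\rangle$ if $\mathrm{type}(\mathtt{y})<\mathrm{type}(\mathtt{x})$. Orient4: $\langle \mathtt{empty} = \mathtt{x}\mathtt{:}L,\sigma\rangle \Rightarrow \langle \mathtt{x}\mathtt{:}L = \mathtt{empty},\sigma\rangle$ if $\mathrm{type}(\mathtt{x})=\mathtt{list}$. Failure rules (each yields $\mathtt{fail}$, which has no successors): Occur: $\langle\mathtt{x}=L,\sigma\rangle$ with $\mathtt{x}\in\mathrm{Var}(L)$, $\mathtt{x}\neq L$, $\mathrm{type}(\mathtt{x})=\mathtt{list}$; Clash1: $\langle \mathtt{a}\mathtt{:}L=\mathtt{b}\mathtt{:}M,\sigma\rangle$ with $\mathtt{a}\neq\mathtt{b}$ both variable-free; Clash2: $\langle \mathtt{a}\mathtt{:}L=\mathtt{empty},\sigma\rangle$; Clash3: $\langle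 \mathtt{empty}=\mathtt{a}\mathtt{:}L,\sigma\rangle$; Clash4: $\langle \mathtt{x}=L,\sigma\rangle$ with $\mathrm{type}(\mathtt{x})\,\|\,\mathrm{type}(L)$. *)

(* Defs.v *)
From Stdlib Require String.
From HB Require Import structures.
From mathcomp Require Import all_boot all_order all_algebra.

Set Implicit Arguments.
Unset Strict Implicit.
Unset Printing Implicit Defensive.

Inductive ty := TInt | TString | TAtom | TList.

Definition ty_eqb (t u : ty) : bool :=
  match t, u with
  | TInt, TInt | TString, TString | TAtom, TAtom | TList, TList => true
  | _, _ => false
  end.

Lemma ty_eqP : Equality.axiom ty_eqb.
Proof. by do 2!case; constructor. Qed.

HB.instance Definition _ := hasDecEq.Build ty ty_eqP.

Definition le_ty (t u : ty) : bool :=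
  match t, u with
  | _, TList => true
  | TInt, TAtom | TString, TAtom => true
  | _, _ => t == u
  end.

Definition lt_ty (t u : ty) : bool := (t != u) && le_ty t u.

Definition incomparable_ty (t u : ty) : bool := ~~ le_ty t u && ~~ le_ty u t.

(* A variable carries its type, so the four sorts of variables are disjoint,
   and there are infinitely many variables of each sort. *)
Definition var : Type := (ty * nat)%type.

Definition vtype (x : var) : ty := x.1.

Inductive expr :=
  | EInt of int
  | EStr of String.string
  | EEmpty
  | EVar of var
  | ECat of expr & expr.

Fixpoint items (e : expr) : seq expr :=
  match e with
  | EEmpty => [::]
  | ECat e1 e2 => items e1 ++ items e2
  | _ => [:: e]
  end.

Fixpoint of_items (s : seq expr) : expr :=
  match s with
  | [::] => EEmpty
  | [:: e] => e
  | e :: s' => ECat e (of_items s')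
  end.

(* The normal form for [L : empty -> L] and [empty : L -> L].  As list
   concatenation is associative and written without parentheses, the normal
   form is moreover bracketed to the right. *)
Definition norm (e : expr) : expr := of_items (items e).

Definition etype (e : expr) : ty :=
  match norm e with
  | EInt _ => TInt
  | EStr _ => TString
  | EVar x => vtype x
  | EEmpty | ECat _ _ => TList
  end.

(* The variables of an expression, in order and with multiplicity. *)
Fixpoint vars (e : expr) : seq var :=
  match e with
  | EVar x => [:: x]
  | ECat e1 e2 => vars e1 ++ vars e2
  | _ => [::]
  end.

Definition is_list_var (x : var) : bool := vtype x == TList.

(* Concatenation is the only operator of [expr], so only the condition on
   list variables remains. *)
Definition simple (e : expr) : bool := count is_list_var (vars e) <= 1.

Definition is_const (e : expr) : bool :=
  match e with EInt _ | EStr _ => true | _ => false end.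

(* The range of the metavariables a, b of the rules. *)
Definition is_atom_item (e : expr) : bool :=
  match e with
  | EInt _ | EStr _ => true
  | EVar x => ~~ is_list_var x
  | _ => false
  end.

(* The range of the metavariable s of the rules. *)
Definition is_item (e : expr) : bool :=
  match e with EInt _ | EStr _ | EVar _ => true | _ => false end.

(* [None] means that the variable is outside the domain. *)
Definition subst : Type := var -> option expr.

Definition wt_subst (sg : subst) : Prop :=
  forall x e, sg x = Some e -> le_ty (etype e) (vtype x).

Fixpoint app (sg : subst) (e : expr) : expr :=
  match e with
  | EVar x => odflt e (sg x)
  | ECat e1 e2 => ECat (app sg e1) (app sg e2)
  | _ => e
  end.

Definition single (x : var) (e : expr) : subst :=
  fun y => if y == x then Some e else None.

(* In diagrammatic order: [sg] first, then [th]. *)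
Definition comp (sg th : subst) : subst :=
  fun x => if sg x is Some e then Some (app th e) else th x.

(* A state of the transformation system.  Not every state is a unification
   problem: for instance, Decomp1' may create a variable common to both sides
   of the equation. *)
Inductive problem :=
  | Eqn of expr & expr & subst
  | Solved of subst
  | Fail.

Definition unification_problem (P : problem) : Prop :=
  match P with
  | Eqn s t sg =>
      [/\ simple s, simple t, ~~ has (mem (vars s)) (vars t) & wt_subst sg]
  | Solved sg => wt_subst sg
  | Fail => True
  end.

Definition no_repeated_list_vars (P : problem) : Prop :=
  match P with
  | Eqn s t _ => uniq (filter is_list_var (vars s ++ vars t))
  | _ => True
  end.

Definition norm_subst (sg : subst) : subst := fun x => omap norm (sg x).

Definition norm_problem (P : problem) : problem :=
  match P with
  | Eqn s t sg => Eqn (norm s) (norm t) (norm_subst sg)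
  | Solved sg => Solved (norm_subst sg)
  | Fail => Fail
  end.

Definition nonempty (e : expr) : Prop := norm e <> EEmpty.

(* Eliminated list variables stay in the domain of [sg]; hence, in a derivation
   from a problem without repeated list variables, [z] is also distinct from
   all list variables used earlier. *)
Definition fresh (z : var) (s t : expr) (sg : subst) : Prop :=
  [/\ is_list_var z, z \notin vars s, z \notin vars t, sg z = None &
      forall y e, sg y = Some e -> z \notin vars e].

(* The instances of the rules, before normalisation. *)
Inductive rule : problem -> problem -> Prop :=
  | Remove L sg :
      simple L ->
      rule (Eqn L L sg) (Solved sg)
  | Decomp1 x s L M sg :
      simple L -> simple M -> is_item s ->
      nonempty L -> vtype x = TList ->
      rule (Eqn (ECat (EVar x) L) (ECat s M) sg)
           (Eqn L M (comp sg (single x s)))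
  | Decomp1' x a L M sg :
      simple L -> simple M -> is_atom_item a ->
      nonempty L -> le_ty (etype a) (vtype x) -> le_ty (vtype x) TAtom ->
      rule (Eqn (ECat (EVar x) L) (ECat a M) sg)
           (Eqn (app (single x a) L) (app (single x a) M)
                (comp sg (single x a)))
  | Decomp2 x y x' L M sg :
      simple L -> simple M ->
      nonempty L -> vtype x = TList -> vtype y = TList ->
      fresh x' (ECat (EVar x) L) (ECat (EVar y) M) sg ->
      rule (Eqn (ECat (EVar x) L) (ECat (EVar y) M) sg)
           (Eqn (ECat (EVar x') L) M
                (comp sg (single x (ECat (EVar y) (EVar x')))))
  | Decomp2' x y y' L M sg :
      simple L -> simple M ->
      nonempty L -> vtype x = TList -> vtype y = TList ->
      fresh y' (ECat (EVar x) L) (ECat (EVar y) M) sg ->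
      rule (Eqn (ECat (EVar x) L) (ECat (EVar y) M) sg)
           (Eqn L (ECat (EVar y') M)
                (comp sg (single y (ECat (EVar x) (EVar y')))))
  | Decomp3 s L M sg :
      simple L -> simple M -> is_item s ->
      rule (Eqn (ECat s L) (ECat s M) sg) (Eqn L M sg)
  | Decomp4 x a y sg :
      is_atom_item a -> vtype x = TAtom -> vtype y = TList ->
      rule (Eqn (EVar x) (ECat a (EVar y)) sg)
           (Eqn EEmpty (EVar y) (comp sg (single x a)))
  | Subst1 x L sg :
      simple L -> x \notin vars L -> le_ty (etype L) (vtype x) ->
      rule (Eqn (EVar x) L sg) (Solved (comp sg (single x L)))
  | Subst2 x L M sg :
      simple L -> simple M -> nonempty L -> vtype x = TList ->
      rule (Eqn (ECat (EVar x) L) M sg) (Eqn L M (comp sg (single x EEmpty)))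
  | Subst3 x a x' L M sg :
      simple L -> simple M -> is_atom_item a ->
      nonempty L -> fresh x' (ECat (EVar x) L) (ECat a M) sg ->
      vtype x = TList ->
      rule (Eqn (ECat (EVar x) L) (ECat a M) sg)
           (Eqn (ECat (EVar x') L) M
                (comp sg (single x (ECat a (EVar x')))))
  | Orient1 a x L M sg :
      simple L -> simple M -> is_const a ->
      rule (Eqn (ECat a M) (ECat (EVar x) L) sg)
           (Eqn (ECat (EVar x) L) (ECat a M) sg)
  | Orient2 x y L sg :
      simple L -> nonempty L -> vtype x = vtype y ->
      rule (Eqn (ECat (EVar x) L) (EVar y) sg)
           (Eqn (EVar y) (ECat (EVar x) L) sg)
  | Orient3 x y L M sg :
      simple L -> simple M -> lt_ty (vtype y) (vtype x) ->
      rule (Eqn (ECat (EVar y) M) (ECat (EVar x) L) sg)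
           (Eqn (ECat (EVar x) L) (ECat (EVar y) M) sg)
  | Orient4 x L sg :
      simple L -> vtype x = TList ->
      rule (Eqn EEmpty (ECat (EVar x) L) sg)
           (Eqn (ECat (EVar x) L) EEmpty sg)
  | Occur x L sg :
      simple L -> x \in vars L -> norm L <> EVar x -> vtype x = TList ->
      rule (Eqn (EVar x) L sg) Fail
  | Clash1 a b L M sg :
      simple L -> simple M -> is_const a -> is_const b -> a <> b ->
      rule (Eqn (ECat a L) (ECat b M) sg) Fail
  | Clash2 a L sg :
      simple L -> is_atom_item a ->
      rule (Eqn (ECat a L) EEmpty sg) Fail
  | Clash3 a L sg :
      simple L -> is_atom_item a ->
      rule (Eqn EEmpty (ECat a L) sg) Fail
  | Clash4 x L sg :
      simple L -> incomparable_ty (vtype x) (etype L) ->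
      rule (Eqn (EVar x) L sg) Fail.

(* Problems are matched up to normalisation, and results are normalised. *)
Definition step (P Q : problem) : Prop :=
  exists P0 Q0, [/\ rule P0 Q0, norm_problem P0 = norm_problem P &
                    Q = norm_problem Q0].

(* Main.v *)
(** Every rule other than the Orient rules shortens the equation or leaves a
    problem without successors; the substitutions applied by Decomp1' replace
    items by single items.  An Orient rule exchanges the two sides, and after
    any of them no Orient rule applies.  Hence twice the length of the equation,
    plus one if its sides can be exchanged, strictly decreases. *)

Require Import Defs.
From mathcomp Require Import all_boot all_order all_algebra.
From mathcomp Require Import zify.

Lemma items_of_items s : items (of_items s) = flatten (map items s).
Proof.
elim: s => [|e [|e' s] IHs] //; first by rewrite /= cats0.
by rewrite [map _ _]/= [flatten _]/= -[_ ++ flatten _]IHs.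
Qed.

Lemma items_norm e : items (norm e) = items e.
Proof.
rewrite /norm items_of_items; elim: e => //= e1 IH1 e2 IH2.
by rewrite map_cat flatten_cat IH1 IH2.
Qed.

Lemma size_items_gt0 e : nonempty e -> 0 < size (items e).
Proof. by rewrite /nonempty /norm; case: (items e). Qed.

Lemma is_atom_item_item a : is_atom_item a -> is_item a.
Proof. by case: a. Qed.

Lemma size_items_item a : is_item a -> size (items a) = 1.
Proof. by case: a. Qed.

Lemma size_items_app x a e :
  is_item a -> size (items (app (single x a) e)) = size (items e).
Proof.
move=> a_item; elim: e => //= [y|e1 IH1 e2 IH2].
  by rewrite /single; case: (y == x) => //=; rewrite size_items_item.
by rewrite !size_cat IH1 IH2.
Qed.

(** Covers the left-hand sides of Orient4, Orient1, Orient2 and Orient3, in this order. Reading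
    items instead of expressions makes it invariant under normalisation. *)
Definition orientable (u v : seq expr) : bool :=
  match u, v with
  | [::], EVar _ :: _ => true
  | EInt _ :: _, EVar _ :: _ | EStr _ :: _, EVar _ :: _ => true
  | EVar x :: u', EVar y :: v' =>
      [&& vtype x == vtype y, 0 < size u' & size v' == 0]
      || lt_ty (vtype x) (vtype y)
  | _, _ => false
  end.

(** The successor puts every equation, even one between empty sides, strictly above [Solved] and
    [Fail]. *)
Definition measure (P : problem) : nat :=
  match P with
  | Eqn s t _ =>
      ((size (items s) + size (items t)).*2
       + orientable (items s) (items t)).+1
  | _ => 0
  end.

Lemma measure_norm P : measure (norm_problem P) = measure P.
Proof. by case: P => //= s t sg; rewrite !items_norm. Qed.

(** Losing one item lowers the doubled length by two, while [orientable] can add at most one. *)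
Lemma measure_shorter s t sg s' t' sg' :
  size (items s') + size (items t') < size (items s) + size (items t) ->
  measure (Eqn s' t' sg') < measure (Eqn s t sg).
Proof. by move=> /=; do 2!case: orientable; lia. Qed.

Lemma measure_swap s t sg sg' :
  orientable (items s) (items t) -> ~~ orientable (items t) (items s) ->
  measure (Eqn t s sg') < measure (Eqn s t sg).
Proof. by move=> /= -> /negbTE ->; lia. Qed.

Lemma lt_ty_asym t u : lt_ty t u -> ~~ lt_ty u t.
Proof. by case: t; case: u. Qed.

Lemma lt_ty_irr t : lt_ty t t = false.
Proof. by case: t. Qed.

Lemma lt_ty_neq t u : lt_ty t u -> u == t = false.
Proof. by case: t; case: u. Qed.

Lemma rule_measure P Q : rule P Q -> measure Q < measure P.
Proof.
(* The rules that remain are those yielding an equation. *)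
case=> //.
- move=> x s L M sg _ _ s_item _ _; apply: measure_shorter => /=.
  rewrite size_cat (size_items_item _ s_item); lia.
- move=> x a L M sg _ _ /is_atom_item_item a_item _ _ _.
  apply: measure_shorter => /=.
  rewrite size_cat !size_items_app // (size_items_item _ a_item); lia.
(* Decomp2 and Decomp2': one head disappears, a fresh variable replaces the other. *)
- by move=> *; apply: measure_shorter => /=; lia.
- by move=> *; apply: measure_shorter => /=; lia.
- move=> s L M sg _ _ s_item; apply: measure_shorter => /=.
  rewrite !size_cat (size_items_item _ s_item); lia.
- move=> x a y sg /is_atom_item_item a_item _ _; apply: measure_shorter => /=.
  rewrite size_cat (size_items_item _ a_item); lia.
- by move=> *; apply: measure_shorter => /=; lia.
- move=> x a x' L M sg _ _ /is_atom_item_item a_item _ _ _.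
  apply: measure_shorter => /=; rewrite size_cat (size_items_item _ a_item); lia.
- by move=> a x L M sg _ _ a_const; apply: measure_swap; case: a a_const.
(* Orient2 cannot be undone: after the exchange the left side has an empty tail. *)
- move=> x y L sg _ /size_items_gt0 L_gt0 eq_xy.
  by apply: measure_swap; rewrite /= ?eq_xy ?eqxx ?L_gt0 ?lt_ty_irr.
- move=> x y L M sg _ _ lt_yx; apply: measure_swap => /=.
    by rewrite lt_yx orbT.
  by rewrite (lt_ty_neq _ _ lt_yx) lt_ty_asym.
- by move=> *; apply: measure_swap.
Qed.

Lemma step_measure P Q : step P Q -> measure Q < measure P.
Proof.
case=> P0 [Q0 [rPQ eqP ->]].
by rewrite -(measure_norm P) -eqP !measure_norm rule_measure.
Qed.

Theorem theorem1 (P : problem) (hP : unification_problem P)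
    (hrep : no_repeated_list_vars P) :
  ~ exists p : nat -> problem,
      p 0 = P /\ forall n : nat, step (p n) (p n.+1).
Proof.
case=> p [_ p_step].
have bound n : measure (p n) + n <= measure (p 0).
  elim: n => [|n IHn]; first by rewrite addn0.
  by have := step_measure _ _ (p_step n); lia.
(* One step more than the initial measure allows. *)
by have := bound (measure (p 0)).+1; lia.
Qed.
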